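(* Let $K$ be a prime link diagram without curls, let $i\in K_1$ be a segment, and let $\mathrm{Irr}(i)$ be the set of join irreducible elements of the lattice $L(i)$ of Kauffman states relative to $i$, identified with the modules $M(j,k)$, $j\in K_1$, $1\le k\le d_j$. Then the map $f_i\colon \mathrm{Irr}(i)\to B(i)$, $M(j,k)\mapsto b_{j,k}$, is a bijection.
   Context: Link diagrams. A link diagram $K$ is a projection of a link to the plane that is injective except for finitely many transversal double points (crossing points). It is regarded as a cellular decomposition of the oriented sphere $S^2$: $K_0$ is the set of crossing points (nonempty), $K_1$ the set of segments (edges; every crossing point is incident to four segments and every segment to two crossing points), $K_2$ the set of regions of the complement; $|K_1|=2|K_0|$ and $|K_2|=|K_0|+2$ (so $K$ is connected). A curl is a monogon region; $K$ is without curls if it has no monogon. ''Prime link diagram'' means: the link is prime (not the connected sum of two nontrivial links), and the diagram is prime, i.e. every simple closed curve in $S^2$ meeting $K$ transversally in exactly two points, both interior points of segments, bounds on one side a disc containing no crossing points. ''Clockwise'' is with respect to the fixed orientation of the plane. Kauffman states. Let $i\in K_1$, with adjacent regions $R_i,R_i'$. A marker is a pair $(x,R)$ with $x\in K_0$, $R\in K_2$, $x$ incident to $R$. A Kauffman state relative to $i$ is a set of markers such that each crossing point is used in exactly one marker, each region other than $R_i,R_i'$ is used in exactly one marker, and $R_i,R_i'$ are used in no marker. Let $j$ be a segment with endpoints $x,y$ and adjacent regions $R_1,R_2$ such that going clockwise around $x$ one passes from $R_1$ to $R_2$ when crossing $j$. A state $\mathcal S'$ is obtained from $\mathcal S$ by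 a counterclockwise transposition at $j$ if $\mathcal S$ contains $(x,R_2),(y,R_1)$, $\mathcal S'$ contains $(x,R_1),(y,R_2)$, and all other markers agree. Put $\mathcal S_1<\mathcal S_2$ if a (nonempty) sequence of counterclockwise transpositions transforms $\mathcal S_1$ into $\mathcal S_2$. This is a partial order with a unique minimal and a unique maximal element (Kauffman); the resulting poset $L(i)$ is a lattice. The quiver $Q$. Its vertices are the segments, $Q_0=K_1$. For every crossing point with segments $a_1,a_2,a_3,a_4$ in clockwise order draw arrows $a_1\to a_2\to a_3\to a_4\to a_1$; then remove all 2-cycles. Each remaining arrow $\alpha:j\to k$ corresponds to a position $(x,R)$ in the diagram: the region $R$ at the crossing point $x$ lying between $j$ and the next segment $k$ in clockwise direction. The representation $T(i)=(T(i)_j,\phi_\alpha)$ of $Q$ over an algebraically closed field $\Bbbk$. For $j\in K_1$ let $d_j=\dim T(i)_j$ be the number of transpositions at $j$ in any sequence of counterclockwise transpositions from the minimal to the maximal Kauffman state relative to $i$ (this number does not depend on the sequence). $T(i)_j$ is the $\Bbbk$-vector space with basis $B(i)_j=\{b_{j,1},\dots,b_{j,d_j}\}$, and $B(i)=\bigcup_jB(i)_j$. For every arrow $\alpha:j\to k$ one has $|d_j-d_k|\le 1$, and $\phi_\alpha:T(i)_j\to T(i)_k$ is given by: - if $d_k=d_j+1$: $\phi_\alpha(b_{j,m})=b_{k,m}$ for all $m$; - if $d_k=d_j-1$: $\phi_\alpha(b_{j,m})=b_{k,m-1}$ for $m\ge2$ and $\phi_\alpha(b_{j,1})=0$; - if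 $d_k=d_j$ and the position $(x,R)$ corresponding to $\alpha$ is a marker of the minimal Kauffman state: $\phi_\alpha(b_{j,m})=b_{k,m-1}$ for $m\ge2$ and $\phi_\alpha(b_{j,1})=0$ (nilpotent Jordan block); - if $d_k=d_j$ and $(x,R)$ is not a marker of the minimal Kauffman state: $\phi_\alpha(b_{j,m})=b_{k,m}$ for all $m$ (identity). For $j\in K_1$, $1\le k\le d_j$, $M(j,k)$ is the submodule of $T(i)$ generated by $\{b_{j,1},\dots,b_{j,k}\}$. The isomorphism $\Phi$ (known from earlier work). There is an isomorphism of posets $\Phi$ from $L(i)$ to the poset of submodules of $T(i)$ ordered by inclusion, such that $\mathcal S'$ is obtained from $\mathcal S$ by a counterclockwise transposition at $j$ if and only if $M=\Phi(\mathcal S)\subset M'=\Phi(\mathcal S')$ satisfy $M'_k=M_k$ for $k\ne j$ and $\dim M'_j=\dim M_j+1$. Elements of $L(i)$ are identified with submodules via $\Phi$; under this identification the join irreducible elements (elements $c$, not the minimum, such that $c=a\vee b$ implies $c=a$ or $c=b$) are the modules $M(j,k)$. *)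

(* Defs.v *)
From HB Require Import structures.
From mathcomp Require Import all_boot all_order all_algebra.
From mathcomp Require Import all_classical all_reals all_analysis.

Set Implicit Arguments.
Unset Strict Implicit.
Unset Printing Implicit Defensive.

Import Order.TTheory GRing.Theory Num.Theory.
Import numFieldNormedType.Exports.

Local Open Scope classical_set_scope.
Local Open Scope ring_scope.

(** * Four-valent maps on an oriented surface *)

(* A dart is a segment together with one of its ends. The darts at a crossing
   point x are (x, 0), (x, 1), (x, 2), (x, 3) in clockwise order, and opp
   exchanges the two ends of a segment. *)
Record map4 := Map4 {
  crossing : finType;
  opp : crossing * 'I_4 -> crossing * 'I_4;
  oppK : involutive opp;
  opp_neq : forall d, opp d != d }.

Notation dart K := (crossing K * 'I_4)%type.

Section Map4.
Variable K : map4.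

Definition cw (d : dart K) : dart K := (d.1, ordS d.2).
Definition ccw (d : dart K) : dart K := (d.1, ord_pred d.2).

Definition segment_set (d : dart K) : {set dart K} := [set d; opp d]%SET.
Definition segment : finType :=
  {A : {set dart K} | A \in codom segment_set}.
Definition segment_of (d : dart K) : segment :=
  exist _ (segment_set d) (codom_f segment_set d).

(* A dart d also stands for the corner at d.1 between d and the next dart in
   clockwise direction. The region of that corner lies on the clockwise side of
   d; following d to its other end, the next corner of the region is the one
   just before opp d. Regions are the cycles of this walk. *)
Definition next_corner (d : dart K) : dart K := ccw (opp d).
Definition region_set (d : dart K) : {set dart K} :=
  [set d' | fconnect next_corner d d']%SET.
Definition region : finType :=
  {A : {set dart K} | A \in codom region_set}.
Definition region_of (d : dart K) : region :=
  exist _ (region_set d) (codom_f region_set d).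

(* The two regions adjacent to the segment of d are region_of d, clockwise from
   d, and region_of (opp d), counterclockwise from d. *)
Definition adjacent (j : segment) (A : region) : bool :=
  [exists d in val j, A == region_of d].

Definition no_curl : Prop := forall d : dart K, next_corner d != d.

Definition neighbour : rel (dart K) :=
  [rel d d' | (d' == cw d) || (d' == opp d)].

End Map4.

(** * Links and link diagrams *)

Section Topology.
Variable R : realType.

Notation plane := (R * R)%type.
Notation space := (R * R * R)%type.
Notation sphere2 := (one_point_compactification plane).

Definition homeo (X : topologicalType) (h : X -> X) : Prop :=
  exists g : X -> X, [/\ cancel h g, cancel g h, continuous h & continuous g].

(* f restricts to a homeomorphism from the open set U onto Y. *)
Definition chart (X Y : topologicalType) (U : set X) (f : X -> Y) : Prop :=
  [/\ open U, {within U, continuous f} &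
      exists g : Y -> X,
        [/\ continuous g, forall x, U x -> g (f x) = x &
            forall y, U (g y) /\ f (g y) = y]].

(* A compact locally flat 1-dimensional submanifold, that is, a tame finite
   disjoint union of simple closed curves. *)
Definition is_link (L : set space) : Prop :=
  [/\ L !=set0, compact L &
      forall p, L p -> exists (U : set space) (f : space -> space),
        [/\ U p, chart U f &
            forall q, U q -> (L q <-> (f q).1.1 = 0 /\ (f q).1.2 = 0)]].

Definition round_circle (n : nat) : set space :=
  [set p | (p.1.1 - 3 * n%:R) ^+ 2 + p.1.2 ^+ 2 = 1 /\ p.2 = 0].

(* Mirror images are allowed here (h need not preserve the orientation); a
   link is trivial if and only if its mirror image is. *)
Definition trivial_link (L : set space) : Prop :=
  exists (n : nat) (h : space -> space),
    homeo h /\ h @` L = \bigcup_(m in [set m | (m < n)%N]) round_circle m.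

Definition sqnorm3 (p : space) : R := p.1.1 ^+ 2 + p.1.2 ^+ 2 + p.2 ^+ 2.

Definition meridian : set space :=
  [set p | [/\ sqnorm3 p = 1, p.1.2 = 0 & 0 <= p.1.1]].

(* After a homeomorphism of space, L meets the unit sphere exactly in the two
   poles; L1 and L2 are obtained from the part inside and the part outside by
   joining the poles by an arc of the sphere. Asking that L1 and L2 be links
   forces L to cross the sphere at both poles. *)
Definition connected_sum (L L1 L2 : set space) : Prop :=
  [/\ is_link L1, is_link L2 &
    exists h : space -> space,
      [/\ homeo h,
          h @` L `&` [set p | sqnorm3 p = 1] = [set (0, 0, 1); (0, 0, -1)],
          L1 = (h @` L `&` [set p | sqnorm3 p <= 1]) `|` meridian &
          L2 = (h @` L `&` [set p | 1 <= sqnorm3 p]) `|` meridian]].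

Definition prime_link (L : set space) : Prop :=
  ~ exists L1 L2, [/\ connected_sum L L1 L2, ~ trivial_link L1
                    & ~ trivial_link L2].

Definition cross (u v : plane) : R := u.1 * v.2 - u.2 * v.1.

(* A four-valent map drawn as the projection of a link to the plane. For a dart
   d, strand d parametrizes by [0, 1] the part of the link above the segment of
   d, starting above the crossing point of d; the projection forgets the last
   coordinate. *)
Record link_diagram := LinkDiagram {
  shape :> map4;
  crossing_nonempty : (0 < #|crossing shape|)%N;
  shape_connected : forall d d' : dart shape, connect (@neighbour shape) d d';
  shape_spherical : #|region shape| = (#|crossing shape| + 2)%N;
  strand : dart shape -> R -> space;
  strand_continuous : forall d, {within `[0, 1], continuous (strand d)};
  strand_opp : forall d t, 0 <= t <= 1 -> strand (opp d) t = strand d (1 - t);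
  strand_through : forall d, strand (cw (cw d)) 0 = strand d 0;
  strand_cross : forall d, (strand (cw d) 0).1 = (strand d 0).1;
  strand_over : forall d, (strand (cw d) 0).2 != (strand d 0).2;
  crossing_inj : forall d d', (strand d 0).1 = (strand d' 0).1 -> d.1 = d'.1;
  segment_inj : forall d d' t t', 0 < t < 1 -> 0 < t' < 1 ->
    (strand d t).1 = (strand d' t').1 ->
    (d' = d /\ t' = t) \/ (d' = opp d /\ t' = 1 - t);
  segment_crossing : forall d d' t, 0 < t < 1 ->
    (strand d t).1 <> (strand d' 0).1;
  tangent : dart shape -> plane;
  tangent_x : forall d,
    ((strand d t).1.1 - (strand d 0).1.1) / t @[t --> 0^'+] --> (tangent d).1;
  tangent_y : forall d,
    ((strand d t).1.2 - (strand d 0).1.2) / t @[t --> 0^'+] --> (tangent d).2;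
  tangent_through : forall d, tangent (cw (cw d)) = - tangent d;
  tangent_clockwise : forall d, cross (tangent d) (tangent (cw d)) < 0 }.

Definition link_of (K : link_diagram) : set space :=
  [set p | exists d t, 0 <= t <= 1 /\ p = @strand K d t].

Definition drawing (K : link_diagram) : set sphere2 :=
  [set Some p.1 | p in link_of K].

Definition crossing_points (K : link_diagram) : set sphere2 :=
  [set Some (@strand K d 0).1 | d in [set: dart K]].

Definition simple_closed_curve (C : set sphere2) : Prop :=
  exists c : R -> sphere2,
    [/\ {within `[0, 1], continuous c}, c 0 = c 1,
        forall s t, 0 <= s < 1 -> 0 <= t < 1 -> c s = c t -> s = t
      & C = c @` `[0, 1]].

Definition transversal_at (A B : set sphere2) (p : sphere2) : Prop :=
  exists (U : set sphere2) (f : sphere2 -> plane),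
    [/\ U p, chart U f, forall q, U q -> (A q <-> (f q).2 = 0)
      & forall q, U q -> (B q <-> (f q).1 = 0)].

(* The closed curve C bounds a closed disc that contains no point of X; such a
   disc is the closure of one of the two sides of C. *)
Definition bounds_disc_avoiding (C X : set sphere2) : Prop :=
  exists e : plane -> sphere2,
    let disc := [set p : plane | p.1 ^+ 2 + p.2 ^+ 2 <= 1] in
    [/\ {within disc, continuous e},
        forall p q, disc p -> disc q -> e p = e q -> p = q,
        C = e @` [set p | p.1 ^+ 2 + p.2 ^+ 2 = 1]
      & e @` disc `&` X = set0].

Definition prime_shape (K : link_diagram) : Prop :=
  forall (C : set sphere2) (p q : sphere2),
    simple_closed_curve C -> p <> q -> C `&` drawing K = [set p; q] ->
    ~ crossing_points K p -> ~ crossing_points K q ->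
    transversal_at (drawing K) C p -> transversal_at (drawing K) C q ->
    bounds_disc_avoiding C (crossing_points K).

Definition prime_link_diagram (K : link_diagram) : Prop :=
  prime_link (link_of K) /\ prime_shape K.

End Topology.

(** * Kauffman states *)

Section States.
Variables (K : map4) (i : segment K).

Notation marker := (crossing K * region K)%type.

Definition corner_marker (d : dart K) : marker := (d.1, region_of d).

Definition is_kstate (S : {set marker}) : bool :=
  [&& [forall m in S, [exists d, m == corner_marker d]],
      [forall x, #|[set m in S | m.1 == x]%SET| == 1%N] &
      [forall A, #|[set m in S | m.2 == A]%SET|
                   == (if adjacent i A then 0 else 1)%N]].

Definition kstate : finType := {S : {set marker} | is_kstate S}.

(* With d one of the two ends of j, x := d.1 and y := (opp d).1, going clockwise
   around x one passes from R1 := region_of (opp d) to R2 := region_of d when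
   crossing j. Exchanging d and opp d gives the same condition. *)
Definition transposition (j : segment K) (S S' : kstate) : bool :=
  [exists d in val j,
    let x := d.1 in let y := (opp d).1 in
    let R1 := region_of (opp d) in let R2 := region_of d in
    [&& (x, R2) \in val S, (y, R1) \in val S,
        (x, R1) \in val S', (y, R2) \in val S'
      & val S :\: [set (x, R2); (y, R1)] == val S' :\: [set (x, R1); (y, R2)]
    ]%SET].

Definition state_le : rel kstate :=
  connect [rel S S' | [exists j, transposition j S S']].

Definition state_min (S : kstate) : bool := [forall S', state_le S S'].
Definition state_max (S : kstate) : bool := [forall S', state_le S' S].

Fixpoint transposition_seq (S : kstate) (p : seq (segment K * kstate))
    (S' : kstate) : bool :=
  if p is (j, S1) :: p' then transposition j S S1 && transposition_seq S1 p' S'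
  else S == S'.

Definition transposition_number (d : segment K -> nat) : Prop :=
  forall S S' p, state_min S -> state_max S' -> transposition_seq S p S' ->
  forall j, count (fun a => a.1 == j) p = d j.

End States.

Definition is_join (T : Type) (le : T -> T -> Prop) (a b c : T) : Prop :=
  [/\ le a c, le b c & forall u, le a u -> le b u -> le c u].

Definition join_irreducible (T : Type) (le : T -> T -> Prop) (c : T) : Prop :=
  ~ (forall u, le c u) /\ forall a b, is_join le a b c -> c = a \/ c = b.

Definition Irr (K : map4) (i : segment K) : set (kstate i) :=
  [set S | join_irreducible (fun S1 S2 => state_le S1 S2) S].

Arguments Irr {K} i.

(** * Quivers, representations and submodules *)

Record quiver := Quiver {
  vertex : finType;
  arrow : finType;
  source : arrow -> vertex;
  target : arrow -> vertex }.

Record representation (F : fieldType) (Q : quiver) := Representation {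
  rep_space : vertex Q -> vectType F;
  rep_map : forall a : arrow Q,
    'Hom(rep_space (source a), rep_space (target a)) }.

Section Submodules.
Variables (F : fieldType) (Q : quiver) (V : representation F Q).

Record submodule := Submodule {
  sub_space :> forall j : vertex Q, {vspace rep_space V j};
  sub_stable : forall a : arrow Q,
    (rep_map V a @: sub_space (source a) <= sub_space (target a))%VS }.

Definition submodule_le (M N : submodule) : Prop :=
  forall j, (M j <= N j)%VS.

Definition homogeneous := {j : vertex Q & rep_space V j}.

Definition contains (M : submodule) (X : set homogeneous) : Prop :=
  forall v, X v -> tagged v \in M (tag v).

Definition generated_by (X : set homogeneous) (M : submodule) : Prop :=
  contains M X /\ forall N, contains N X -> submodule_le M N.

End Submodules.

(** * The quiver of a diagram and the representation T(i) *)

Section Representation.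
Variables (F : fieldType) (K : map4).

(* The arrow at the corner d goes from the segment of d to the next one in
   clockwise direction; the arrows which are part of a 2-cycle are removed. *)
Definition arrow_src (d : dart K) : segment K := segment_of d.
Definition arrow_tgt (d : dart K) : segment K := segment_of (cw d).
Definition in_2cycle (d : dart K) : bool :=
  [exists d', (arrow_src d' == arrow_tgt d) && (arrow_tgt d' == arrow_src d)].

Definition diagram_quiver : quiver :=
  @Quiver (segment K) {d : dart K | ~~ in_2cycle d}
    (fun a => arrow_src (val a)) (fun a => arrow_tgt (val a)).

Variables (i : segment K) (d : segment K -> nat).

Definition min_marker (c : dart K) : bool :=
  [exists S : kstate i, state_min S && (corner_marker c \in val S)].

(* Matrices act on row vectors on the right and indices start at 0: row m is
   the image of the basis vector b_{j,m+1}. The last case does not occur. *)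
Definition keep_mx (p q : nat) : 'M[F]_(p, q) :=
  \matrix_(m < p, n < q) (n == m :> nat)%:R.
Definition shift_mx (p q : nat) : 'M[F]_(p, q) :=
  \matrix_(m < p, n < q) (n.+1 == m :> nat)%:R.

Definition phi_mx (c : dart K) : 'M[F]_(d (arrow_src c), d (arrow_tgt c)) :=
  if d (arrow_tgt c) == (d (arrow_src c)).+1 then keep_mx _ _
  else if d (arrow_src c) == (d (arrow_tgt c)).+1 then shift_mx _ _
  else if d (arrow_tgt c) == d (arrow_src c) then
    if min_marker c then shift_mx _ _ else keep_mx _ _
  else 0.

Definition T_rep : representation F diagram_quiver :=
  @Representation F diagram_quiver (fun j => 'rV[F]_(d j))
    (fun a => linfun (mulmxr (phi_mx (val a)))).

Definition basis_vector (j : segment K) (m : 'I_(d j)) : homogeneous T_rep :=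
  Tagged (fun j => 'rV[F]_(d j)) (delta_mx 0 m).

Definition B : set (homogeneous T_rep) :=
  [set v | exists j m, v = @basis_vector j m].

(* M is the module M(j, m + 1). *)
Definition is_M (j : segment K) (m : 'I_(d j)) (M : submodule T_rep) : Prop :=
  generated_by [set v | exists n : 'I_(d j), (n <= m)%N /\ v = basis_vector n]
    M.

Definition is_Phi (Phi : kstate i -> submodule T_rep) : Prop :=
  [/\ bijective Phi,
      forall S S', state_le S S' <-> submodule_le (Phi S) (Phi S')
    & forall S S' j, transposition j S S' <->
        [/\ submodule_le (Phi S) (Phi S'),
            forall k, k != j -> Phi S' k = Phi S k
          & \dim (Phi S' j) = (\dim (Phi S j)).+1]].

End Representation.

Arguments T_rep F {K} i d.
Arguments B F {K} i d.
Arguments basis_vector F {K} i {d j} m.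

(* Main.v *)
(** Kauffman states are finite in number, hence so are the submodules of T(i),
    and every inclusion of submodules refines to steps that add one dimension
    at one segment. If M_j and N_j were incomparable for two submodules M and
    N, with u in M_j but not in N_j and v in N_j but not in M_j, then a minimal
    submodule containing u and v would have two distinct maximal submodules,
    both of codimension one at j; the pencil of hyperplanes spanned by these
    would consist of submodules, infinitely many as the field is infinite.
    So the subspaces M_j form a chain for every j. The maps of T(i) are
    triangular, so this chain contains, hence equals, the flag of the spans of
    b_{j,1}, ..., b_{j,k}, and M(j,k) is the least submodule whose component
    at j contains b_{j,k}. *)

Require Import Defs.
From mathcomp Require Import all_boot all_order all_algebra.
From mathcomp Require Import all_classical all_reals all_analysis.

Set Implicit Arguments.
Unset Strict Implicit.
Unset Printing Implicit Defensive.

Import GRing.Theory.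

Local Open Scope classical_set_scope.
Local Open Scope ring_scope.

(** * Infinitude of closed fields *)

Lemma closedField_fin_not_inj (F : closedFieldType) (T : finType) (g : F -> T) :
  ~ injective g.
Proof.
move=> g_inj.
pose h y := xget (0 : F) [set x | g x = y].
have hK x : h (g x) = x.
  by apply: g_inj; rewrite /h; case: xgetP => [y _ ->//|/(_ x) []].
(* If [g] is injective, every field element is a root of this nonzero polynomial, whereas a closed
   field has a non-root. *)
pose p : {poly F} := \prod_(y : T) ('X - (h y)%:P).
have p_neq0 : p != 0.
  by apply/prodf_neq0 => y _; rewrite polyXsubC_eq0.
have [x /negP []] := closed_nonrootP _ p_neq0.
by rewrite /p /root horner_prod (bigD1 (g x)) //= hornerXsubC hK subrr mul0r.
Qed.

(** * Submodules of a quiver representation and steps of codimension one *)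

Section Submodules.
Variables (F : fieldType) (Q : quiver) (V : representation F Q).
Implicit Types M N : submodule V.

Lemma submodule_eq M N : (forall j, M j = N j) -> M = N.
Proof.
case: M N => [M Ms] [N Ns] /= eqMN.
have {eqMN} eqMN : M = N by apply: functional_extensionality_dep.
by case: N / eqMN Ns => Ns; congr Submodule; apply: Prop_irrelevance.
Qed.

Lemma submodule_anti M N : submodule_le M N -> submodule_le N M -> M = N.
Proof.
by move=> MN NM; apply: submodule_eq => j; apply: subv_anti; rewrite MN NM.
Qed.

Lemma submodule_act M (a : arrow Q) v :
  v \in M (source a) -> rep_map V a v \in M (target a).
Proof. by move=> Mv; apply: (subvP (sub_stable M a)); exact: memv_img. Qed.

Lemma submodule_of_act (U : forall j : vertex Q, {vspace rep_space V j}) :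
  (forall (a : arrow Q) v,
     v \in U (source a) -> rep_map V a v \in U (target a)) ->
  exists M, forall j, M j = U j.
Proof.
move=> Uact.
have Us (a : arrow Q) : (rep_map V a @: U (source a) <= U (target a))%VS.
  by apply/subvP => _ /memv_imgP[v Uv ->]; exact: Uact.
by exists (Submodule Us).
Qed.

Lemma submodule_cap M N :
  exists P : submodule V, forall j, P j = (M j :&: N j)%VS.
Proof.
apply: submodule_of_act => a v; rewrite !memv_cap => /andP[Mv Nv].
by rewrite !submodule_act.
Qed.

Lemma submodule_add M N :
  exists P : submodule V, forall j, P j = (M j + N j)%VS.
Proof.
apply: submodule_of_act => a _ /memv_addP[u Mu [v Nv ->]].
by rewrite linearD memv_add // submodule_act.
Qed.

Lemma submodule_zero : exists P : submodule V, forall j, P j = 0%VS.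
Proof.
apply: submodule_of_act => a v; rewrite memv0 => /eqP->.
by rewrite linear0 mem0v.
Qed.

(** The quotient of [N] by [M] is simple at [j]: the condition that [is_Phi] attaches to a
    transposition. *)
Definition simple_step M N j :=
  [/\ submodule_le M N, forall k, k != j -> N k = M k
    & \dim (N j) = (\dim (M j)).+1].

Lemma simple_step_notin j M N : simple_step M N j ->
  exists2 v, v \in N j & v \notin M j.
Proof.
case=> MN _ dimN; apply/subvPn/negP => NM.
by have := dimvS NM; rewrite dimN ltnn.
Qed.

(** By dimension, [N j] is [M j] plus the line of [v]. *)
Lemma simple_step_le j M N P v : simple_step M N j ->
  v \in N j -> v \notin M j -> submodule_le M P -> v \in P j ->
  submodule_le N P.
Proof.
move=> [MN eqMN dimN] Nv M'v MP Pv k.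
have [->|neq_kj] := eqVneq k j; last first.
  by rewrite eqMN.
have MvN : (M j + <[v]> <= N j)%VS by rewrite subv_add MN -memvE.
suffices <- : (M j + <[v]>)%VS = N j by rewrite subv_add MP -memvE.
apply/eqP; rewrite eqEdim MvN dimN.
rewrite (ltn_leqif (dimv_leqif_sup (addvSl _ _))) subv_add subvv -memvE.
exact: M'v.
Qed.

End Submodules.

(** * Representations with finitely many submodules *)

Section FiniteLattice.
Variables (F : closedFieldType) (Q : quiver) (V : representation F Q).
Variables (S : finType) (Phi : S -> submodule V).
Implicit Types M N P : submodule V.
Hypothesis Phi_surj : forall M, exists s, Phi s = M.

(** The intersection of all submodules containing [X] runs over the finite index type [S]. *)
Lemma submodule_generated (X : set (homogeneous V)) :
  exists M, generated_by X M.
Proof.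
pose C := [pred s | `[< contains (Phi s) X >]].
have [M defM] : exists M, forall j, M j = (\bigcap_(s | C s) Phi s j)%VS.
  apply: submodule_of_act => a v /[!memvE] /subv_bigcapP Cv.
  apply/subv_bigcapP => s Cs; rewrite -memvE submodule_act // memvE; exact: Cv.
exists M; split=> [v Xv | N XN j].
  rewrite defM memvE; apply/subv_bigcapP => s /asboolP XPs.
  by rewrite -memvE; exact: XPs.
have [s defN] := Phi_surj N; rewrite -defN in XN *.
by rewrite defM; apply: (bigcapv_inf s) => //; apply/asboolP.
Qed.

Hypothesis no_loop : forall a : arrow Q, source a != target a.

(* Otherwise all the hyperplanes between B1 and B2 define submodules, and there
   are infinitely many of them. *)
Lemma simple_step_uniq j B1 B2 P :
  simple_step B1 P j -> simple_step B2 P j -> B1 = B2.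
Proof.
move=> stB1 stB2; have [leB1 eqB1 _] := stB1; have [leB2 eqB2 _] := stB2.
have eq_of_sub A B : simple_step A P j -> simple_step B P j ->
    (A j <= B j)%VS -> A = B.
  move=> [_ eqA dimA] [_ eqB dimB] leAB; apply: submodule_eq => k.
  have [->|neq_kj] := eqVneq k j; last by rewrite -eqA ?eqB.
  by apply/eqP; rewrite eqEdim leAB /= -ltnS -dimA dimB.
have [le12|/subvPn[u B1u B2'u]] := boolP (B1 j <= B2 j)%VS.
  exact: eq_of_sub.
have [le21|/subvPn[v B2v B1'v]] := boolP (B2 j <= B1 j)%VS.
  by symmetry; exact: eq_of_sub.
(* Extended by 0 away from [j], so that one formula gives the pencil at every vertex. *)
pose w t := dfwith (fun k => 0 : rep_space V k) j (u + t *: v).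
have wP t k : w t k \in P k.
  have [->|neq_kj] := eqVneq k j; last by rewrite /w dfwithout ?mem0v // eq_sym.
  rewrite /w dfwithin memvD ?memvZ //.
    exact: (subvP (leB1 j)).
  exact: (subvP (leB2 j)).
have pencil t : exists H : submodule V,
    forall k, H k = (B1 k :&: B2 k + <[w t k]>)%VS.
  apply: submodule_of_act => a x.
  (* An arrow out of [j] ends where [B1], [B2] and [P] agree, so stability of [P] suffices. *)
  have [src_j|src_j] := eqVneq (source a) j.
    have tgt_j : target a != j by rewrite -src_j eq_sym no_loop.
    move=> Hx; rewrite /w dfwithout 1?eq_sym // -eqB1 // -eqB2 // capvv.
    apply: (subvP (addvSl _ _)); apply: submodule_act.
    apply: subvP Hx; rewrite subv_add -memvE.
    by rewrite (subv_trans (capvSl _ _) (leB1 _)) wP.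
  rewrite /w dfwithout 1?eq_sym // addv0 memv_cap => /andP[B1x B2x].
  by apply: (subvP (addvSl _ _)); rewrite memv_cap !submodule_act.
have /choice[H defH] := pencil.
have /choice[g defg] : forall t, exists s, Phi s = H t.
  by move=> t; exact: Phi_surj.
(* A coincidence [H t1 = H t2] with distinct parameters would put both [u] and [v] into
   [B1 j :&: B2 j] plus one line. *)
case: (@closedField_fin_not_inj F S g) => t1 t2 eqg.
have eqH : H t1 = H t2 by rewrite -!defg eqg.
apply/eqP/negPn/negP => neqt.
have wH t : u + t *: v \in H t j.
  rewrite defH /w dfwithin; apply: (subvP (addvSr _ _)); exact: memv_line.
have vH : v \in H t1 j.
  have : (t1 - t2) *: v \in H t1 j.
    have -> : (t1 - t2) *: v = (u + t1 *: v) - (u + t2 *: v).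
      by rewrite scalerBl opprD addrACA subrr add0r.
    by rewrite memvB // eqH.
  by rewrite rpredZeq subr_eq0 (negPf neqt).
have uH : u \in H t1 j.
  have -> : u = (u + t1 *: v) - t1 *: v by rewrite addrK.
  by rewrite memvB // memvZ.
move: vH; rewrite defH /w dfwithin => /memv_addP[x] /memv_capP[B1x B2x].
move=> [_ /vlineP[c ->] defv].
(* In [v = x + c(u + t1 v)], a nonzero [c] forces [u] into [B2 j], and [c = 0] forces [v] into
   [B1 j]. *)
have c0 : c = 0.
  apply: contraNeq B2'u => c_neq0.
  have : c *: u \in B2 j.
    have -> : c *: u = v - x - (c * t1) *: v.
      by rewrite {1}defv [x + _]addrC addrK scalerDr scalerA addrK.
    by rewrite !memvB // memvZ.
  by rewrite rpredZeq (negPf c_neq0).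
by move: B1'v; rewrite defv c0 scale0r addr0 B1x.
Qed.

Hypothesis refine : forall M N, submodule_le M N -> M <> N ->
  exists B j, submodule_le M B /\ simple_step B N j.

Lemma submodule_comparable M N j : (M j <= N j)%VS || (N j <= M j)%VS.
Proof.
have [//|/subvPn[u Mu N'u]] := boolP (M j <= N j)%VS.
have [//|/subvPn[v Nv M'v]] := boolP (N j <= M j)%VS.
pose hom (w : rep_space V j) : homogeneous V :=
  Tagged (fun k => rep_space V k : Type) w.
pose X := [set hom u; hom v].
have [P [PX minP]] := submodule_generated X.
have Pu : u \in P j by apply: (PX (hom u)); left.
have Pv : v \in P j by apply: (PX (hom v)); right.
have P_le (A : submodule V) : u \in A j -> v \in A j -> submodule_le P A.
  by move=> Au Av; apply: minP => _ [->|->].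
(* A step into [P] at another vertex would keep [u] and [v], which generate [P]. *)
have step_at (A B : submodule V) k : submodule_le A B -> simple_step B P k ->
    (u \in A j) || (v \in A j) -> k = j.
  move=> AB stB Auv; apply/eqP; apply: contraT; rewrite eq_sym => neq_jk.
  have [x Px B'x] := simple_step_notin stB.
  have [_ eqB _] := stB.
  have PB : submodule_le P B by apply: P_le; rewrite -eqB.
  by case/negP: B'x; exact: (subvP (PB k)).
(* Refine the proper inclusion of [A :&: P] in [P]; used for [u] in [M] and for [v] in [N]. *)
have cover (A : submodule V) x : x \in A j -> x \in [:: u; v] ->
    ~~ ((u \in A j) && (v \in A j)) -> exists2 B, simple_step B P j & x \in B j.
  move=> Ax xuv A'uv; have [C defC] := submodule_cap A P.
  have CP : submodule_le C P by move=> k; rewrite defC capvSr.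
  have neqCP : C <> P.
    move=> eqCP; case/negP: A'uv; move: Pu Pv.
    by rewrite -eqCP defC !memv_cap => /andP[-> _] /andP[-> _].
  have Px : x \in P j by move: xuv; rewrite !inE => /orP[] /eqP->.
  have Cx : x \in C j by rewrite defC memv_cap Ax.
  have [B [k [CB stB]]] := refine CP neqCP.
  exists B; last exact: (subvP (CB j)).
  rewrite -(step_at _ _ _ CB stB) //.
  by move: xuv; rewrite !inE => /orP[] /eqP <-; rewrite Cx ?orbT.
have [B1 st1 B1u] : exists2 B, simple_step B P j & u \in B j.
  by apply: (cover M); rewrite ?inE ?eqxx // negb_and M'v orbT.
have [B2 st2 B2v] : exists2 B, simple_step B P j & v \in B j.
  by apply: (cover N); rewrite ?inE ?eqxx ?orbT // negb_and N'u.
have eqB := simple_step_uniq st1 st2.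
have [x Px B1'x] := simple_step_notin st1.
have /(_ j)/subvP/(_ x Px) : submodule_le P B1.
  by apply: P_le => //; rewrite eqB.
by rewrite (negPf B1'x).
Qed.

End FiniteLattice.

(** * The representation T(i) and its flags *)

Section DiagramRepresentation.
Variables (F : closedFieldType) (K : map4) (i : segment K).
Variable d : segment K -> nat.
Notation T := (T_rep F i d).
Notation e n := (delta_mx 0 n).

(** A loop satisfies [in_2cycle] with itself as the return arrow. *)
Lemma diagram_quiver_no_loop (a : arrow (diagram_quiver K)) :
  source a != target a.
Proof.
apply: contra (valP a) => /eqP eq_a; apply/existsP; exists (val a).
by rewrite /= in eq_a; rewrite eq_a eqxx.
Qed.

Lemma basis_coord0 p (n k : 'I_p) : n != k :> nat -> (e n : 'rV[F]_p) 0 k = 0.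
Proof.
move=> neq_nk.
by rewrite mxE eqxx /= -(inj_eq val_inj) eq_sym (negPf neq_nk).
Qed.

(** [keep_mx] preserves the index of a basis vector and [shift_mx] lowers it; neither raises it. *)
Lemma phi_mx_triangular (c : dart K) (n : 'I_(d (arrow_src c)))
    (m : 'I_(d (arrow_tgt c))) :
  (n < m)%N -> phi_mx F i d c n m = 0.
Proof.
rewrite /phi_mx => lt_nm.
have keep0 : keep_mx F _ _ n m = 0 by rewrite /keep_mx mxE gtn_eqF.
have shift0 : shift_mx F _ _ n m = 0 by rewrite /shift_mx mxE gtn_eqF // ltnW.
by do ![case: ifP => _ //]; rewrite mxE.
Qed.

(* The vectors supported on the first k basis vectors of each T(i)_j. *)
Lemma filtration k : exists M : submodule T,
  forall j (v : 'rV[F]_(d j)),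
    v \in M j <-> forall n : 'I_(d j), (k <= n)%N -> v 0 n = 0.
Proof.
pose U (j : segment K) : {vspace 'rV[F]_(d j)} :=
  lker (linfun (mulmxr (copid_mx k : 'M[F]_(d j)))).
have UP j (v : 'rV[F]_(d j)) :
    v \in U j <-> forall n : 'I_(d j), (k <= n)%N -> v 0 n = 0.
  rewrite memv_ker lfunE /= mulmxBr mulmx1 subr_eq0.
  have pidE n : (v *m (pid_mx k : 'M[F]_(d j))) 0 n =
      if (n < k)%N then v 0 n else 0.
    rewrite mxE (bigD1 n) //= big1 ?addr0 => [|m neq_mn].
      by rewrite mxE eqxx; case: ifP; rewrite ?mulr1 ?mulr0.
    by rewrite mxE (inj_eq val_inj) (negPf neq_mn) mulr0.
  split=> [/eqP-> n le_kn | v0]; first by rewrite pidE ltnNge le_kn.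
  by apply/eqP/rowP => n; rewrite pidE; case: ltnP => // /v0.
have [M defM] : exists M : submodule T, forall j, M j = U j.
  apply: submodule_of_act => a v /UP v0; apply/UP => m le_km.
  rewrite /= lfunE /= mxE big1 // => n _.
  have [le_kn|lt_nk] := leqP k n; first by rewrite v0 ?mul0r.
  by rewrite phi_mx_triangular ?mulr0 // (leq_trans lt_nk).
by exists M => j v; rewrite defM.
Qed.

Variable Phi : kstate i -> submodule T.
Hypothesis PhiP : is_Phi Phi.
Implicit Types (M N P : submodule T) (j : segment K).

Lemma Phi_surj M : exists S, Phi S = M.
Proof. by have [[Psi _ PsiK] _ _] := PhiP; exists (Psi M). Qed.

(** The last transposition on a path of states from [M] to [N] is the step sought. *)
Lemma Phi_refine M N : submodule_le M N -> M <> N ->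
  exists B j, submodule_le M B /\ simple_step B N j.
Proof.
have [_ Phi_le Phi_step] := PhiP.
have [S <-] := Phi_surj M; have [S' <-] := Phi_surj N.
move=> /Phi_le/connectP[p]; case/lastP: p => [|p S'' +]; first by move=> _ ->.
rewrite rcons_path last_rcons => /andP[path_p /existsP[j step]] defS' _.
rewrite -{S''}defS' in step.
exists (Phi (last S p)), j; split; first by apply/Phi_le/connectP; exists p.
exact/Phi_step.
Qed.

Lemma T_comparable M N j : (M j <= N j)%VS || (N j <= M j)%VS.
Proof.
apply: (submodule_comparable Phi_surj) => //; last exact: Phi_refine.
exact: diagram_quiver_no_loop.
Qed.

(** [M j] is comparable with every span of initial basis vectors, hence is itself such a span. *)
Lemma mem_basis M j (v : 'rV[F]_(d j)) (n m : 'I_(d j)) :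
  v \in M j -> v 0 n != 0 -> (m <= n)%N -> e m \in M j.
Proof.
move=> Mv vn le_mn; have [U UP] := filtration n.
have UM : (U j <= M j)%VS.
  have [|//] := orP (T_comparable M U j).
  by move=> /subvP/(_ v Mv)/UP v0; rewrite v0 ?eqxx in vn.
have [eq_mn|neq_mn] := eqVneq m n; last first.
  apply: (subvP UM); apply/UP => k le_nk; apply: basis_coord0.
  by rewrite ltn_eqF // (leq_trans _ le_nk) // ltn_neqAle neq_mn.
rewrite {m le_mn}eq_mn; have [U' U'P] := filtration n.+1.
(* If [M j] lies in the span of [e 0, ..., e n], then subtracting the [n]-th term of [v] lands in
   [U j], which is inside [M j]. *)
have [MU'|] := orP (T_comparable M U' j); last first.
  move=> /subvP; apply; apply/U'P => k lt_nk.
  by rewrite basis_coord0 // ltn_eqF.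
have /U'P v0 := subvP MU' v Mv.
have Mw : v - v 0 n *: e n \in M j.
  apply: (subvP UM); apply/UP => k.
    rewrite leq_eqVlt => /orP[/eqP/val_inj<-|lt_nk].
    by rewrite !mxE !eqxx mulr1 subrr.
  by rewrite 3!mxE (v0 k) // basis_coord0 ?mulr0 ?subr0 // ltn_eqF.
have : v 0 n *: e n \in M j by rewrite -(subKr v (v 0 n *: e n)) memvB.
by rewrite rpredZeq (negPf vn).
Qed.

Lemma basis_le M N j :
  (forall n, e n \in M j -> e n \in N j) -> (M j <= N j)%VS.
Proof.
move=> MN; apply/subvP => v Mv; rewrite [v]row_sum_delta memv_suml // => n _.
have [->|vn] := eqVneq (v 0 n) 0; first by rewrite scale0r mem0v.
by rewrite memvZ // MN // (mem_basis Mv vn).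
Qed.

Lemma mem_basis_le M j (n m : 'I_(d j)) :
  e n \in M j -> (m <= n)%N -> e m \in M j.
Proof. by move=> Mn; apply: mem_basis Mn _; rewrite mxE !eqxx oner_eq0. Qed.

(** * The modules M(j, k) *)

Lemma is_M_mem j (m : 'I_(d j)) M : is_M m M -> e m \in M j.
Proof. by case=> cM _; apply: (cM (basis_vector F i m)); exists m. Qed.

(** The last generator [e m] alone yields the others, by [mem_basis_le]. *)
Lemma is_M_le j (m : 'I_(d j)) M N :
  is_M m M -> e m \in N j -> submodule_le M N.
Proof.
move=> [_ minM] Nm; apply: minM => _ [n [le_nm ->]].
exact: mem_basis_le Nm _.
Qed.

Lemma is_M_ex j (m : 'I_(d j)) : exists M, is_M m M.
Proof. exact: submodule_generated Phi_surj _. Qed.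

(** The filtration submodule of level [m.+1] contains [e m] but no later basis vector at [j]. *)
Lemma is_M_memE j (m n : 'I_(d j)) M : is_M m M -> (e n \in M j) = (n <= m)%N.
Proof.
move=> genM; apply/idP/idP => [Mn|]; last exact/mem_basis_le/is_M_mem.
have [U UP] := filtration m.+1; rewrite leqNgt; apply/negP => lt_mn.
have : e n \in U j.
  apply: (subvP (is_M_le genM _ j)) Mn; apply/UP => k lt_mk.
  by rewrite basis_coord0 // ltn_eqF.
by move=> /UP/(_ n lt_mn)/eqP; rewrite mxE !eqxx oner_eq0.
Qed.

(** A step at another vertex would keep the generator [e m]. *)
Lemma is_M_step j (m : 'I_(d j)) k M B : is_M m M -> simple_step B M k -> k = j.
Proof.
move=> genM stB; have [v Mv B'v] := simple_step_notin stB.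
have [_ eqB _] := stB; apply/eqP; rewrite eq_sym; apply: contraT => neq_jk.
case/negP: B'v; apply: (subvP (is_M_le genM _ k)) => //.
by rewrite -eqB // is_M_mem.
Qed.

Lemma is_M_neq0 j (m : 'I_(d j)) M : is_M m M -> ~ (forall N, submodule_le M N).
Proof.
move=> genM; have [Z Z0] := submodule_zero T.
move=> /(_ Z j)/subvP/(_ _ (is_M_mem genM)).
rewrite Z0 memv0 => /eqP/rowP/(_ m)/eqP.
by rewrite !mxE !eqxx oner_eq0.
Qed.

Lemma refine_nonzero M : ~ (forall N, submodule_le M N) ->
  exists B j, simple_step B M j.
Proof.
move=> nzM; have [Z Z0] := submodule_zero T.
have ZM : submodule_le Z M by move=> j; rewrite Z0 sub0v.
have neqZM : Z <> M.
  by move=> eqZM; apply: nzM => N j; rewrite -eqZM Z0 sub0v.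
by have [B [j [_ stB]]] := Phi_refine ZM neqZM; exists B, j.
Qed.

(* The simple top of M(j, m) sits at the vertex j, which determines j. *)
Lemma is_M_inj j (m : 'I_(d j)) j' (m' : 'I_(d j')) M :
  is_M m M -> is_M m' M -> basis_vector F i m = basis_vector F i m'.
Proof.
move=> genM genM'; have [B [k stB]] := refine_nonzero (is_M_neq0 genM).
have eq_jj' : j' = j by rewrite -(is_M_step genM' stB) (is_M_step genM stB).
case: j / eq_jj' m genM => m genM; congr basis_vector; apply/val_inj/eqP.
rewrite eqn_leq -(is_M_memE _ genM') (is_M_mem genM).
by rewrite -(is_M_memE _ genM) (is_M_mem genM').
Qed.

(** If M(j, k) is the join of [A] and [B], it lies in [A + B], whose component at [j] is that of [A]
    or of [B], so one of them contains the generator. Conversely, [M] is the join of a maximal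
    submodule [B] and the module generated by a basis vector of [M] outside [B]. *)
Lemma join_irreducible_is_M M :
  join_irreducible (@submodule_le _ _ T) M <->
  exists j (m : 'I_(d j)), is_M m M.
Proof.
split=> [[nzM irrM]|[j [m genM]]]; last first.
  split=> [|A B [AM BM minM]]; first exact: is_M_neq0 genM.
  have [C defC] := submodule_add A B.
  have MC : submodule_le M C.
    by apply: minM => k; rewrite defC ?addvSl ?addvSr.
  have /(subvP (MC j)) := is_M_mem genM; rewrite defC => Cm.
  have eqM N : e m \in N j -> submodule_le N M -> M = N.
    by move=> Nm NM; apply: submodule_anti => //; exact: is_M_le genM Nm.
  have [/addv_idPr AB|/addv_idPl BA] := orP (T_comparable A B j).
    by right; apply: eqM => //; rewrite -AB.
  by left; apply: eqM => //; rewrite -BA.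
have [B [j stB]] := refine_nonzero nzM.
have [BM _ _] := stB.
have [n Mn B'n] : exists2 n, e n \in M j & e n \notin B j.
  apply: contrapT => MB; have [v Mv] := simple_step_notin stB.
  case/negP; apply: subvP Mv; apply: basis_le => n Mn.
  by apply: contraT => B'n; case: MB; exists n.
exists j, n; have [C genC] := is_M_ex n.
have CM := is_M_le genC Mn.
suffices [eqMB|-> //] : M = B \/ M = C by rewrite -eqMB Mn in B'n.
apply: irrM; split=> // N BN CN; apply: (simple_step_le stB Mn B'n BN).
exact: (subvP (CN j)) (is_M_mem genC).
Qed.

(** Join irreducibility is transported along the order isomorphism [Phi]. *)
Lemma Irr_Phi S : Irr i S <-> exists j (m : 'I_(d j)), is_M m (Phi S).
Proof.
have [[Psi PhiK PsiK] Phi_le _] := PhiP.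
rewrite -join_irreducible_is_M; split=> -[nmin irr]; split.
- by apply: contra_not nmin => min u; apply/Phi_le; exact: min.
- move=> A B [AS BS minS]; rewrite -[A]PsiK -[B]PsiK in AS BS minS *.
  case: (irr (Psi A) (Psi B)) => [|->|->]; [|by left|by right].
  by split=> [||u Au Bu]; apply/Phi_le => //; apply: minS; exact/Phi_le.
- apply: contra_not nmin => min N; rewrite -[N]PsiK.
  by apply/Phi_le; exact: min.
- move=> A B [/Phi_le AS /Phi_le BS minS].
  case: (irr (Phi A) (Phi B)) => [|/(can_inj PhiK)|/(can_inj PhiK)];
    [|by left|by right].
  split=> // N; rewrite -[N]PsiK => /Phi_le AN /Phi_le BN.
  exact/Phi_le/minS.
Qed.

End DiagramRepresentation.

(** * The bijection onto the basis *)

Theorem corollary4p3 (R : realType) (F : closedFieldType)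
    (K : link_diagram R) (hprime : prime_link_diagram K) (hcurl : no_curl K)
    (i : segment K) (d : segment K -> nat) (hd : transposition_number i d)
    (Phi : kstate i -> submodule (T_rep F i d)) (hPhi : is_Phi Phi) :
  Phi @` Irr i = [set M | exists j (m : 'I_(d j)), is_M m M] /\
  exists f : kstate i -> homogeneous (T_rep F i d),
    (forall S j (m : 'I_(d j)), Irr i S -> is_M m (Phi S) ->
       f S = basis_vector F i m) /\
    set_bij (Irr i) (B F i d) f.
Proof.
have IrrP S := Irr_Phi hPhi S; have surj := Phi_surj hPhi.
split.
  apply/seteqP; split=> [_ [S /IrrP MS <-]|M MM] //.
  by have [S defM] := surj M; exists S => //; apply/IrrP; rewrite defM.
have /choice[f fP] S : exists v, forall j (m : 'I_(d j)),
    is_M m (Phi S) -> v = basis_vector F i m.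
  have [[j [m genS]]|noM] := pselect (exists j (m : 'I_(d j)), is_M m (Phi S)).
    by exists (basis_vector F i m) => j' m'; apply: (is_M_inj hPhi genS).
  (* Default value for states that are not join irreducible. *)
  exists (Tagged (fun j => 'rV[F]_(d j)) (0 : 'rV[F]_(d i))) => j m genS.
  by case: noM; exists j, m.
exists f; split=> [S j m _|]; first exact: fP.
split.
- by move=> S /IrrP[j [m /fP->]]; exists j, m.
- move=> S S' /[!inE] /IrrP[j [m genS]] /IrrP[j' [m' genS']].
  rewrite (fP _ _ _ genS) (fP _ _ _ genS').
  have [[Psi PhiK _] _ _] := hPhi; move=> eq_b; apply: (can_inj PhiK).
  (* Stated through [tag], so that [eq_b] can be rewritten although [j] and [j'] may differ; each
     module then contains the other's generator. *)
  have mem_b N n (k : 'I_(d n)) : is_M k N ->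
      tagged (basis_vector F i k) \in N (tag (basis_vector F i k)).
    exact: is_M_mem.
  apply: submodule_anti.
    by apply: (is_M_le hPhi genS); have := mem_b _ _ _ genS'; rewrite -eq_b.
  by apply: (is_M_le hPhi genS'); have := mem_b _ _ _ genS; rewrite eq_b.
- move=> _ [j [m ->]]; have [M genM] := is_M_ex hPhi m.
  have [S defM] := surj M; rewrite -defM in genM.
  by exists S; [apply/IrrP; exists j, m | exact: fP].
Qed.
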